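(* Let $n\ge4$, and let $\phi\colon B_n(\mathbb{S}^2)\to\mathcal{MCG}(\mathbb{S}^2,n)$ be the canonical epimorphism with kernel $\langle\Delta_n^2\rangle\cong\mathbb{Z}_2$. (a) Let $H'$ be an infinite virtually cyclic subgroup of $\mathcal{MCG}(\mathbb{S}^2,n)$ of Type I (resp. Type II). Then $\phi^{-1}(H')$ is a virtually cyclic subgroup of $B_n(\mathbb{S}^2)$ of Type I (resp. Type II). (b) Let $H$ be a Type I virtually cyclic subgroup of $B_n(\mathbb{S}^2)$, isomorphic to $F\rtimes_\theta\mathbb{Z}$, where $F$ is a finite subgroup of $B_n(\mathbb{S}^2)$ and $\theta\in\mathrm{Hom}(\mathbb{Z},\mathrm{Aut}(F))$. Then $\phi(H)\cong\phi(F)\rtimes_{\theta'}\mathbb{Z}$, where, setting $F'=\phi(F)$, $\theta'\in\mathrm{Hom}(\mathbb{Z},\mathrm{Aut}(F'))$ satisfies $\theta'(1)(f')=\phi(\theta(1)(f))$ for all $f'\in F'$ and $f\in F$ for which $\phi(f)=f'$. (c) Let $H$ be a Type II virtually cyclic subgroup of $B_n(\mathbb{S}^2)$ isomorphic to $G_1\ast_FG_2$, where $G_1,G_2$ and $F$ are finite subgroups of $B_n(\mathbb{S}^2)$, and $F$ is an index $2$ subgroup of $G_1$ and $G_2$. Then $\phi(H)\cong\phi(G_1)\ast_{\phi(F)}\phi(G_2)$.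
   Context: $B_n(\mathbb{S}^2)$ is the $n$-string braid group of the sphere, generated by $\sigma_1,\ldots,\sigma_{n-1}$ subject to the Artin braid relations and $\sigma_1\cdots\sigma_{n-2}\sigma_{n-1}^2\sigma_{n-2}\cdots\sigma_1=1$. $\Delta_n^2=(\sigma_1\cdots\sigma_{n-1})^n$ is the full twist, the unique element of order $2$ of $B_n(\mathbb{S}^2)$. $\mathcal{MCG}(\mathbb{S}^2,n)$ is the mapping class group of the $n$-punctured sphere (isotopy classes of orientation-preserving homeomorphisms of $\mathbb{S}^2$ leaving a given $n$-point set invariant), and there is a short exact sequence $1\to\langle\Delta_n^2\rangle\to B_n(\mathbb{S}^2)\xrightarrow{\phi}\mathcal{MCG}(\mathbb{S}^2,n)\to1$. A group is virtually cyclic if it has a cyclic subgroup of finite index. An infinite virtually cyclic group is of Type I if it is of the form $F\rtimes_\theta\mathbb{Z}$ with $F$ finite and $\theta\in\mathrm{Hom}(\mathbb{Z},\mathrm{Aut}(F))$, and of Type II if it is of the form $G_1\ast_FG_2$ with $G_1,G_2,F$ finite and $[G_i:F]=2$ for $i=1,2$. In (b) and (c), $F$ (resp. $G_1,G_2,F=G_1\cap G_2$) are the corresponding subgroups of $H$, i.e. $H$ is the internal semi-direct (resp. amalgamated) product. *)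

(* Defs.v *)
From HB Require Import structures.
From mathcomp Require Import all_boot all_order all_algebra.
From mathcomp Require Import all_classical reals topology normedtype trigo.

Set Implicit Arguments.
Unset Strict Implicit.
Unset Printing Implicit Defensive.

Import Order.TTheory GRing.Theory Num.Theory.
Import numFieldNormedType.Exports.

Local Open Scope classical_set_scope.
Local Open Scope card_scope.
Local Open Scope group_scope.
Local Open Scope quotient_scope.

(* For groups, preserving 1 is a consequence of preserving products. *)
Notation group_hom G H := (UMagmaMorphism.type G H).

Definition isomorphic (G H : groupType) : Prop :=
  exists f : group_hom G H, bijective f.

Record subgroup (G : groupType) := Subgroup {
  carrier :> set G;
  subgroup1 : carrier 1;
  subgroupF : forall x y, carrier x -> carrier y -> carrier (x / y)
}.

Section SubgroupGroup.
Variables (G : groupType) (H : subgroup G).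

Lemma subgroup_closed : group_closed (fun x : G => x \in carrier H).
Proof.
split=> [|x y]; first by apply/mem_set; exact: subgroup1.
by move=> /set_mem Hx /set_mem Hy; apply/mem_set; exact: subgroupF.
Qed.

HB.instance Definition _ := SubChoice_isSubGroup.Build G
  (fun x : G => x \in carrier H) {x : G | x \in carrier H} subgroup_closed.

End SubgroupGroup.

Section SubgroupOps.
Variables (G K : groupType) (phi : group_hom G K).

Lemma image_subgroup1 (H : subgroup G) : (phi @` H) 1.
Proof. by exists 1; [exact: subgroup1 | exact: gmulf1]. Qed.

Lemma image_subgroupF (H : subgroup G) x y :
  (phi @` H) x -> (phi @` H) y -> (phi @` H) (x / y).
Proof.
move=> [a Ha <-] [b Hb <-]; exists (a / b); first exact: subgroupF.
exact: gmulfF.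
Qed.

Definition image_subgroup (H : subgroup G) : subgroup K :=
  Subgroup (image_subgroup1 H) (@image_subgroupF H).

Lemma preimage_subgroup1 (H : subgroup K) : (phi @^-1` H) 1.
Proof. by rewrite /preimage /= gmulf1; exact: subgroup1. Qed.

Lemma preimage_subgroupF (H : subgroup K) x y :
  (phi @^-1` H) x -> (phi @^-1` H) y -> (phi @^-1` H) (x / y).
Proof. by rewrite /preimage /= gmulfF; exact: subgroupF. Qed.

Definition preimage_subgroup (H : subgroup K) : subgroup G :=
  Subgroup (preimage_subgroup1 H) (@preimage_subgroupF H).

End SubgroupOps.

Section Inclusion.
Variables (G : groupType) (A B : subgroup G) (sAB : A `<=` B).

Definition inclusion (x : A) : B := SigSub (mem_set (sAB (set_valP x))).

Lemma inclusionF : {morph inclusion : x y / x / y}.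
Proof.
move=> x y; apply: val_inj; rewrite [RHS]gmulfF -[LHS]/(val (x / y)).
exact: gmulfF.
Qed.

HB.instance Definition _ := isGroupMorphism.Build A B inclusion inclusionF.

End Inclusion.

Definition cyclic_set (G : groupType) (x : G) : set G :=
  [set y | exists m : nat, y = x ^+ m \/ y = x ^- m].

(* The cosets g A with g in B. *)
Definition left_cosets (G : groupType) (B A : set G) : set (set G) :=
  [set [set g * a | a in A] | g in B].

Definition virtually_cyclic (G : groupType) : Prop :=
  exists x : G, finite_set (left_cosets [set: G] (cyclic_set x)).

(* The letter (x, false) is the generator x, (x, true) is its inverse. *)
Definition word (X : Type) := seq (X * bool).

Definition inv_word (X : Type) (w : word X) : word X :=
  rev [seq (l.1, ~~ l.2) | l <- w].

Inductive pres_eq (X : Type) (R : word X -> word X -> Prop) :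
    word X -> word X -> Prop :=
  | pres_rel u v : R u v -> pres_eq R u v
  | pres_cancel x b : pres_eq R [:: (x, b); (x, ~~ b)] [::]
  | pres_refl u : pres_eq R u u
  | pres_sym u v : pres_eq R u v -> pres_eq R v u
  | pres_trans u v w : pres_eq R u v -> pres_eq R v w -> pres_eq R u w
  | pres_cat u u' v v' :
      pres_eq R u u' -> pres_eq R v v' -> pres_eq R (u ++ v) (u' ++ v').

Section Presentation.
Variables (X : choiceType) (R : word X -> word X -> Prop).

Definition pres_eqb : rel (word X) := fun u v => `[< pres_eq R u v >].

Lemma pres_eqb_refl : reflexive pres_eqb.
Proof. by move=> u; apply/asboolP; exact: pres_refl. Qed.

Lemma pres_eqb_sym : symmetric pres_eqb.
Proof. by move=> u v; apply/asboolP/asboolP; exact: pres_sym. Qed.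

Lemma pres_eqb_trans : transitive pres_eqb.
Proof.
by move=> v u w /asboolP uv /asboolP vw; apply/asboolP; exact: pres_trans vw.
Qed.

Canonical pres_equiv :=
  EquivRel pres_eqb pres_eqb_refl pres_eqb_sym pres_eqb_trans.

Definition presented : Type := {eq_quot pres_equiv}.
HB.instance Definition _ := Choice.on presented.

Definition word_class (w : word X) : presented := \pi_{eq_quot pres_equiv} w.

Lemma word_classP u v : word_class u = word_class v <-> pres_eq R u v.
Proof.
split=> [/eqP|uv]; first by rewrite /word_class eqmodE => /asboolP.
by apply/eqP; rewrite /word_class eqmodE; apply/asboolP.
Qed.

Definition word_repr (a : presented) : word X :=
  repr (a : {eq_quot pres_equiv}).

Lemma word_reprK : cancel word_repr word_class.
Proof. exact: reprK. Qed.

Lemma word_repr_class w : pres_eq R (word_repr (word_class w)) w.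
Proof. by apply/word_classP; rewrite word_reprK. Qed.

Lemma inv_wordK : involutive (@inv_word X).
Proof.
move=> w; rewrite /inv_word map_rev revK -map_comp -[RHS]map_id.
by apply: eq_map => -[x b] /=; rewrite negbK.
Qed.

Lemma pres_inv_wordl w : pres_eq R (inv_word w ++ w) [::].
Proof.
elim: w => [|[x b] w IHw]; first exact: pres_refl.
rewrite /inv_word /= rev_cons -cats1 -catA /=.
rewrite -[(x, ~~ b) :: _]/([:: (x, ~~ b); (x, b)] ++ w).
apply: pres_trans IHw; apply: pres_cat; first exact: pres_refl.
rewrite -[X in pres_eq R _ X]cat0s; apply: pres_cat; last exact: pres_refl.
by have := pres_cancel R x (~~ b); rewrite negbK.
Qed.

Lemma pres_inv_wordr w : pres_eq R (w ++ inv_word w) [::].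
Proof. by have := pres_inv_wordl (inv_word w); rewrite inv_wordK. Qed.

Lemma pres_inv_word u v : pres_eq R u v -> pres_eq R (inv_word u) (inv_word v).
Proof.
move=> uv; apply: (@pres_trans _ _ _ (inv_word u ++ (v ++ inv_word v))).
  rewrite -[X in pres_eq R X _]cats0; apply: pres_cat; first exact: pres_refl.
  exact/pres_sym/pres_inv_wordr.
rewrite catA -[X in pres_eq R _ X]cat0s; apply: pres_cat; last exact: pres_refl.
apply: pres_trans (pres_inv_wordl u); apply: pres_cat; first exact: pres_refl.
exact: pres_sym.
Qed.

Definition pres_mul (a b : presented) : presented :=
  word_class (word_repr a ++ word_repr b).
Definition pres_inv (a : presented) : presented :=
  word_class (inv_word (word_repr a)).

Lemma word_class_cat u v :
  word_class (u ++ v) = pres_mul (word_class u) (word_class v).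
Proof.
apply/esym/word_classP; apply: pres_cat; exact: word_repr_class.
Qed.

Fact pres_mulA : associative pres_mul.
Proof.
move=> a b c; rewrite -[a]word_reprK -[b]word_reprK -[c]word_reprK.
by rewrite -!word_class_cat catA.
Qed.

Fact pres_mul1 : left_id (word_class [::]) pres_mul.
Proof. by move=> a; rewrite -[a]word_reprK -word_class_cat. Qed.

Fact pres_mulr1 : right_id (word_class [::]) pres_mul.
Proof. by move=> a; rewrite -[a]word_reprK -word_class_cat cats0. Qed.

Lemma word_class_inv w : word_class (inv_word w) = pres_inv (word_class w).
Proof. by apply/esym/word_classP/pres_inv_word; exact: word_repr_class. Qed.

Fact pres_mulV : left_inverse (word_class [::]) pres_inv pres_mul.
Proof.
move=> a; rewrite -[a]word_reprK -word_class_inv -word_class_cat.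
by apply/word_classP; exact: pres_inv_wordl.
Qed.

Fact pres_mulrV : right_inverse (word_class [::]) pres_inv pres_mul.
Proof.
move=> a; rewrite -[a]word_reprK -word_class_inv -word_class_cat.
by apply/word_classP; exact: pres_inv_wordr.
Qed.

HB.instance Definition _ := isGroup.Build presented
  pres_mulA pres_mul1 pres_mulr1 pres_mulV pres_mulrV.

Definition generator (x : X) : presented := word_class [:: (x, false)].

End Presentation.

(* An element of Hom(Z, Aut F). *)
Record hom_Z_Aut (F : groupType) := HomZAut {
  zact :> int -> F -> F;
  zact_bij : forall k, bijective (zact k);
  zactM : forall k, {morph zact k : x y / x * y};
  zactD : forall k l, zact (k + l)%R =1 zact k \o zact l
}.

Definition sdprodZ (F : groupType) (theta : hom_Z_Aut F) : Type :=
  (F * int)%type.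

Section Semidirect.
Variables (F : groupType) (theta : hom_Z_Aut F).

HB.instance Definition _ := Choice.on (sdprodZ theta).

Definition sdprodZ_mul (a b : sdprodZ theta) : sdprodZ theta :=
  (a.1 * theta a.2 b.1, (a.2 + b.2)%R).
Definition sdprodZ_inv (a : sdprodZ theta) : sdprodZ theta :=
  (theta (- a.2)%R a.1^-1, (- a.2)%R).

Lemma zact1 k : theta k 1 = 1.
Proof. by apply: (mulgI (theta k 1)); rewrite -zactM !mulg1. Qed.

Lemma zact0 x : theta 0%R x = x.
Proof.
have /bij_inj := zact_bij theta 0%R; apply.
by have := zactD theta 0%R 0%R x; rewrite addr0.
Qed.

Fact sdprodZ_mulA : associative sdprodZ_mul.
Proof.
move=> [x k] [y l] [z m]; rewrite /sdprodZ_mul /= addrA zactM zactD /=.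
by rewrite mulgA.
Qed.

Fact sdprodZ_mul1 : left_id ((1, 0%R) : sdprodZ theta) sdprodZ_mul.
Proof. by move=> [x k]; rewrite /sdprodZ_mul /= zact0 mul1g add0r. Qed.

Fact sdprodZ_mulr1 : right_id ((1, 0%R) : sdprodZ theta) sdprodZ_mul.
Proof. by move=> [x k]; rewrite /sdprodZ_mul /= zact1 mulg1 addr0. Qed.

Fact sdprodZ_mulV : left_inverse ((1, 0%R) : sdprodZ theta) sdprodZ_inv sdprodZ_mul.
Proof.
by move=> [x k]; rewrite /sdprodZ_mul /= -zactM mulVg zact1 addNr.
Qed.

Fact sdprodZ_mulrV : right_inverse ((1, 0%R) : sdprodZ theta) sdprodZ_inv sdprodZ_mul.
Proof.
move=> [x k]; rewrite /sdprodZ_mul /=.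
have -> : theta k (theta (- k)%R x^-1) = x^-1.
  by have := zactD theta k (- k)%R x^-1; rewrite subrr zact0 /= => <-.
by rewrite mulgV subrr.
Qed.

HB.instance Definition _ := isGroup.Build (sdprodZ theta)
  sdprodZ_mulA sdprodZ_mul1 sdprodZ_mulr1 sdprodZ_mulV sdprodZ_mulrV.

End Semidirect.

Inductive amalgam_rel (F G1 G2 : groupType) (i1 : F -> G1) (i2 : F -> G2) :
    word (G1 + G2)%type -> word (G1 + G2)%type -> Prop :=
  | amalgam_mull x y :
      amalgam_rel i1 i2 [:: (inl x, false); (inl y, false)]
                        [:: (inl (x * y), false)]
  | amalgam_mulr x y :
      amalgam_rel i1 i2 [:: (inr x, false); (inr y, false)]
                        [:: (inr (x * y), false)]
  | amalgam_glue f :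
      amalgam_rel i1 i2 [:: (inl (i1 f), false)] [:: (inr (i2 f), false)].

Definition amalgam (F G1 G2 : groupType) (i1 : F -> G1) (i2 : F -> G2) :
  groupType := presented (amalgam_rel i1 i2).

Definition amalgam_inl (F G1 G2 : groupType) (i1 : F -> G1) (i2 : F -> G2)
  (x : G1) : amalgam i1 i2 := generator (amalgam_rel i1 i2) (inl x).

Definition amalgam_inr (F G1 G2 : groupType) (i1 : F -> G1) (i2 : F -> G2)
  (x : G2) : amalgam i1 i2 := generator (amalgam_rel i1 i2) (inr x).

Definition typeI (G : groupType) : Prop :=
  [/\ infinite_set [set: G], virtually_cyclic G &
      exists (F : groupType) (theta : hom_Z_Aut F),
        finite_set [set: F] /\ isomorphic G (sdprodZ theta)].

Definition typeII (G : groupType) : Prop :=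
  [/\ infinite_set [set: G], virtually_cyclic G &
      exists (F G1 G2 : groupType)
             (i1 : group_hom F G1) (i2 : group_hom F G2),
        [/\ finite_set [set: F] /\ finite_set [set: G1] /\ finite_set [set: G2],
            injective i1 /\ injective i2,
            left_cosets [set: G1] (range i1) #= `I_2 /\
            left_cosets [set: G2] (range i2) #= `I_2 &
            isomorphic G (amalgam i1 i2)]].

(* H is the internal semi-direct product of F by an infinite cyclic group:
   the isomorphism restricts to the identity of F. *)
Definition internal_sdprodZ (G : groupType) (H F : subgroup G)
    (theta : hom_Z_Aut F) : Prop :=
  exists2 f : group_hom (sdprodZ theta) H,
    bijective f & forall x : F, val (f (x, 0%R)) = val x.

Definition internal_amalgam (G : groupType) (H G1 G2 F : subgroup G) : Prop :=
  carrier F = G1 `&` G2 /\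
  exists (s1 : F `<=` G1) (s2 : F `<=` G2)
         (f : group_hom (amalgam (inclusion s1) (inclusion s2)) H),
    [/\ bijective f,
        forall x : G1, val (f (amalgam_inl _ _ x)) = val x &
        forall x : G2, val (f (amalgam_inr _ _ x)) = val x].

(* The generator sigma_(i+1) is indexed by i < n - 1. *)
Inductive sphere_braid_rel (n : nat) :
    word 'I_n.-1 -> word 'I_n.-1 -> Prop :=
  | braid_far (i j : 'I_n.-1) : (i.+1 < j)%N ->
      sphere_braid_rel [:: (i, false); (j, false)] [:: (j, false); (i, false)]
  | braid_near (i j : 'I_n.-1) : i.+1 = j :> nat ->
      sphere_braid_rel [:: (i, false); (j, false); (i, false)]
                       [:: (j, false); (i, false); (j, false)]
  | braid_sphere :
      sphere_braid_rel
        [seq (i, false) | i <- enum 'I_n.-1 ++ rev (enum 'I_n.-1)] [::].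

Definition sphere_braid (n : nat) : groupType := presented (@sphere_braid_rel n).

Definition sigma (n : nat) (i : 'I_n.-1) : sphere_braid n :=
  generator (@sphere_braid_rel n) i.

Definition full_twist (n : nat) : sphere_braid n :=
  (\prod_(i < n.-1) sigma i) ^+ n.

Section Sphere.
Variable R : realType.
Local Open Scope ring_scope.

Definition dot (x y : 'rV[R]_3) : R := \sum_(i < 3) x 0 i * y 0 i.

Definition vec3 (a b c : R) : 'rV[R]_3 := \row_(i < 3) [:: a; b; c]`_i.

Definition cross (x y : 'rV[R]_3) : 'rV[R]_3 :=
  let x_ k := x 0 (inord k) in let y_ k := y 0 (inord k) in
  vec3 (x_ 1%N * y_ 2%N - x_ 2%N * y_ 1%N)
       (x_ 2%N * y_ 0%N - x_ 0%N * y_ 2%N)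
       (x_ 0%N * y_ 1%N - x_ 1%N * y_ 0%N).

Definition sphere : set 'rV[R]_3 := [set x | dot x x = 1].

Definition unit_interval : set R := `[0, 1]%classic.

Definition is_loop (gamma : unit_interval -> sphere) : Prop :=
  continuous gamma /\
  forall s t : unit_interval, val s = 0 -> val t = 1 -> gamma s = gamma t.

(* The loop gamma avoids p and - p and turns k times around p,
   counterclockwise for the outward normal p: (u, v) is an oriented orthonormal
   basis of the tangent plane at p, and rho, theta are polar coordinates of the
   projection of gamma to this plane. *)
Definition winding (gamma : unit_interval -> sphere) (p : sphere) (k : int) :
    Prop :=
  exists (u v : 'rV[R]_3) (rho theta : unit_interval -> R),
    [/\ [/\ dot u u = 1, dot v v = 1, dot u v = 0 & cross u v = val p],
        continuous theta,
        forall t, [/\ 0 < rho t, dot (val (gamma t)) u = rho t * cos (theta t)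
                    & dot (val (gamma t)) v = rho t * sin (theta t)] &
        forall s t : unit_interval, val s = 0 -> val t = 1 ->
          theta t - theta s = 2 * pi * k%:~R].

(* Local degree +1 at every point, the generator of the local homology group
   H_2(S^2, S^2 - p) = H_1(U - p) being read off from winding numbers. *)
Definition orientation_preserving (f : sphere -> sphere) : Prop :=
  forall p : sphere, exists2 U : set sphere, nbhs p U &
    forall gamma, is_loop gamma -> (forall t, (U `\ p) (gamma t)) ->
      forall k, winding gamma p k <-> winding (f \o gamma) (f p) k.

Section MappingClassGroup.
Variable X : set sphere.

Record is_homeo (f : sphere -> sphere) : Prop := IsHomeo {
  homeo_continuous : continuous f;
  homeo_inverse : exists g, [/\ cancel f g, cancel g f & continuous g];
  homeo_orientation : orientation_preserving f;
  homeo_marked : f @` X = X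
}.

Definition homeo : Type := set_type [set f | is_homeo f].
HB.instance Definition _ := Choice.on homeo.

Definition homeo_fun (f : homeo) : sphere -> sphere := val f.
Coercion homeo_fun : homeo >-> Funclass.

Lemma homeoP (f : homeo) : is_homeo f.
Proof. exact: set_valP. Qed.

Lemma homeo_eqP (f g : homeo) : f =1 g -> f = g.
Proof. by move=> fg; apply/val_inj/funext. Qed.

Lemma is_homeo_id : is_homeo id.
Proof.
split; first by move=> x; exact: cvg_id.
- by exists id; split=> // x; exact: cvg_id.
- by move=> p; exists setT; [exact: filterT | by []].
- by rewrite image_id.
Qed.

Lemma is_homeo_comp (f g : sphere -> sphere) :
  is_homeo f -> is_homeo g -> is_homeo (f \o g).
Proof.
move=> [cf [f' [fK f'K cf']] of_ fX] [cg [g' [gK g'K cg']] og gX]; split.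
- by move=> x; apply: continuous_comp; [exact: cg | exact: cf].
- exists (g' \o f'); split; [exact: can_comp | exact: can_comp |].
  by move=> x; apply: continuous_comp; [exact: cf' | exact: cg'].
- move=> p; have [U pU gU] := og p; have [V pV fV] := of_ (g p).
  exists (U `&` g @^-1` V); first by apply: filterI => //; exact: cg.
  move=> gamma lgamma gammaUV k.
  rewrite (gU gamma lgamma); last by move=> t; case: (gammaUV t) => -[].
  rewrite (fV (g \o gamma)) //.
    case: lgamma => cgamma egamma; split; last first.
      by move=> s t s0 t1 /=; rewrite (egamma s t).
    by move=> x; apply: continuous_comp; [exact: cgamma | exact: cg].
  move=> t; case: (gammaUV t) => -[/= _ Vt] ne; split=> //= e.
  by apply: ne; apply: (can_inj gK).
- by rewrite -image_comp gX fX.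
Qed.

Lemma is_homeo_inv (f f' : sphere -> sphere) :
  is_homeo f -> cancel f f' -> cancel f' f -> is_homeo f'.
Proof.
move=> [cf [g [fK gK cg]] of_ fX] ff' f'f.
have -> : f' = g by apply/funext => x; rewrite -[in RHS](f'f x) fK.
split=> //; first by exists f.
- move=> q; have [U qU fU] := of_ (g q).
  exists (g @^-1` U); first exact: cg.
  move=> gamma lgamma gammaU k.
  rewrite (fU (g \o gamma)).
  + have -> : f \o (g \o gamma) = gamma by apply/funext => t /=; rewrite gK.
    by rewrite gK.
  + case: lgamma => cgamma egamma; split; last first.
      by move=> s t s0 t1 /=; rewrite (egamma s t).
    by move=> x; apply: continuous_comp; [exact: cgamma | exact: cg].
  + move=> t; case: (gammaU t) => /= Ut ne; split=> //= e.
    by apply: ne; apply: (can_inj gK).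
- rewrite -[in LHS]fX image_comp; apply/seteqP; split=> [x [y Xy <-]|x Xx] /=.
    by rewrite fK.
  by exists x => //=; rewrite fK.
Qed.

Definition homeo1 : homeo := SigSub (mem_set is_homeo_id).

Definition homeo_mul (f g : homeo) : homeo :=
  SigSub (mem_set (is_homeo_comp (homeoP f) (homeoP g))).

Lemma homeo_inv_subproof (f : homeo) :
  exists g : homeo, [/\ cancel f g, cancel g f & continuous g].
Proof.
have hf := homeoP f; have [_ [g [fK gK cg]] _ _] := hf.
by exists (SigSub (mem_set (is_homeo_inv hf fK gK))).
Qed.

Definition homeo_inv (f : homeo) : homeo := sval (cid (homeo_inv_subproof f)).

Lemma homeo_invK (f : homeo) : cancel f (homeo_inv f).
Proof. by rewrite /homeo_inv; case: cid => g []. Qed.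

Lemma homeo_invKV (f : homeo) : cancel (homeo_inv f) f.
Proof. by rewrite /homeo_inv; case: cid => g []. Qed.

Definition isotopic (f g : homeo) : Prop :=
  exists h : unit_interval -> homeo,
    [/\ continuous (fun z : unit_interval * sphere => h z.1 z.2),
        forall t : unit_interval, val t = 0 -> h t = f &
        forall t : unit_interval, val t = 1 -> h t = g].

Lemma pair_continuous (T U V : topologicalType) (f : T -> U) (g : T -> V) :
  continuous f -> continuous g -> continuous (fun x => (f x, g x)).
Proof. by move=> cf cg x; exact: cvg_pair (cf x) (cg x). Qed.

Lemma isotopy_comp (T : topologicalType) (h k : T -> homeo) :
  continuous (fun z : T * sphere => h z.1 z.2) ->
  continuous (fun z : T * sphere => k z.1 z.2) ->
  continuous (fun z : T * sphere => homeo_mul (h z.1) (k z.1) z.2).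
Proof.
move=> ch ck z.
have c1 : continuous (fst : T * sphere -> T) by move=> x; exact: cvg_fst.
have c2 := pair_continuous c1 ck.
apply: (@continuous_comp _ _ _ (fun z : T * sphere => (z.1, k z.1 z.2))
          (fun z : T * sphere => h z.1 z.2)); last exact: ch.
exact: c2.
Qed.

Lemma isotopy_cst (T : topologicalType) (f : homeo) :
  continuous (fun z : T * sphere => (fun=> f) z.1 z.2).
Proof.
move=> z; apply: (@continuous_comp _ _ _ snd); first exact: cvg_snd.
exact: (homeo_continuous (homeoP f)).
Qed.

Lemma isotopic_refl f : isotopic f f.
Proof. by exists (fun=> f); split=> //; exact: isotopy_cst. Qed.

Lemma unit_interval_rev (t : unit_interval) : 1 - val t \in unit_interval.
Proof.
have := set_valP t; rewrite /unit_interval /= in_itv /= => /andP[t0 t1].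
by apply/mem_set; rewrite /= in_itv /= subr_ge0 t1 lerBlDr lerDl t0.
Qed.

Lemma isotopic_sym f g : isotopic f g -> isotopic g f.
Proof.
move=> [h [ch h0 h1]].
pose r (t : unit_interval) : unit_interval := SigSub (unit_interval_rev t).
have cr : continuous r.
  apply: continuous_comp_initial => t /=.
  apply: (@continuous_comp _ _ _ (val : unit_interval -> R) (fun x => 1 - x)).
    exact: initial_continuous.
  by apply: cvgB; [exact: cvg_cst | exact: cvg_id].
exists (h \o r); split.
- move=> z; apply: (@continuous_comp _ _ _
    (fun z : unit_interval * sphere => (r z.1, z.2))
    (fun z : unit_interval * sphere => h z.1 z.2)); last exact: ch.
  apply: pair_continuous => {}z; last exact: cvg_snd.
  by apply: (@continuous_comp _ _ _ fst); [exact: cvg_fst | exact: cr].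
- by move=> t t0; apply: h1; rewrite /= t0 subr0.
- by move=> t t1; apply: h0; rewrite /= t1 subrr.
Qed.

Lemma isotopic_mul f f' g g' :
  isotopic f f' -> isotopic g g' -> isotopic (homeo_mul f g) (homeo_mul f' g').
Proof.
move=> [h [ch h0 h1]] [k [ck k0 k1]].
exists (fun t => homeo_mul (h t) (k t)); split; first exact: isotopy_comp.
- by move=> t t0; rewrite h0 // k0.
- by move=> t t1; rewrite h1 // k1.
Qed.

Fact homeo_mulA : associative homeo_mul.
Proof. by move=> f g h; exact: homeo_eqP. Qed.

Fact homeo_mul1 : left_id homeo1 homeo_mul.
Proof. by move=> f; exact: homeo_eqP. Qed.

Fact homeo_mulr1 : right_id homeo1 homeo_mul.
Proof. by move=> f; exact: homeo_eqP. Qed.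

Fact homeo_mulV : left_inverse homeo1 homeo_inv homeo_mul.
Proof. by move=> f; apply: homeo_eqP; exact: homeo_invK. Qed.

Fact homeo_mulrV : right_inverse homeo1 homeo_inv homeo_mul.
Proof. by move=> f; apply: homeo_eqP; exact: homeo_invKV. Qed.

HB.instance Definition _ := isGroup.Build homeo
  homeo_mulA homeo_mul1 homeo_mulr1 homeo_mulV homeo_mulrV.

Local Open Scope group_scope.

Lemma isotopicM (f f' g g' : homeo) :
  isotopic f f' -> isotopic g g' -> isotopic (f * g) (f' * g').
Proof. exact: isotopic_mul. Qed.

Lemma isotopic_trans (f g h : homeo) :
  isotopic f g -> isotopic g h -> isotopic f h.
Proof.
move=> fg gh; rewrite -[f]mulg1 -(mulVg g) -[h](mulVKg g).
by apply: isotopicM => //; apply: isotopicM => //; exact: isotopic_refl.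
Qed.

Lemma isotopicV (f g : homeo) : isotopic f g -> isotopic f^-1 g^-1.
Proof.
move=> /isotopic_sym gf.
rewrite -[f^-1](mulKg g) -[g^-1 in X in isotopic _ X]mulg1 -(mulgV f).
by apply: isotopicM; [|apply: isotopicM => //]; exact: isotopic_refl.
Qed.

Definition isotopicb : rel homeo := fun f g => `[< isotopic f g >].

Lemma isotopicb_refl : reflexive isotopicb.
Proof. by move=> f; apply/asboolP; exact: isotopic_refl. Qed.

Lemma isotopicb_sym : symmetric isotopicb.
Proof. by move=> f g; apply/asboolP/asboolP; exact: isotopic_sym. Qed.

Lemma isotopicb_trans : transitive isotopicb.
Proof.
move=> g f h /asboolP fg /asboolP gh; apply/asboolP; exact: isotopic_trans gh.
Qed.

Canonical isotopic_equiv :=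
  EquivRel isotopicb isotopicb_refl isotopicb_sym isotopicb_trans.

Definition mapping_class_group : Type := {eq_quot isotopic_equiv}.
HB.instance Definition _ := Choice.on mapping_class_group.

Definition isotopy_class (f : homeo) : mapping_class_group :=
  \pi_{eq_quot isotopic_equiv} f.

Lemma isotopy_classP f g : isotopy_class f = isotopy_class g <-> isotopic f g.
Proof.
split=> [/eqP|fg]; first by rewrite /isotopy_class eqmodE => /asboolP.
by apply/eqP; rewrite /isotopy_class eqmodE; apply/asboolP.
Qed.

Definition isotopy_repr (a : mapping_class_group) : homeo :=
  repr (a : {eq_quot isotopic_equiv}).

Lemma isotopy_reprK : cancel isotopy_repr isotopy_class.
Proof. exact: reprK. Qed.

Definition mcg_mul (a b : mapping_class_group) : mapping_class_group :=
  isotopy_class (isotopy_repr a * isotopy_repr b).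
Definition mcg_inv (a : mapping_class_group) : mapping_class_group :=
  isotopy_class (isotopy_repr a)^-1.

Lemma isotopy_class_mul f g :
  isotopy_class (f * g) = mcg_mul (isotopy_class f) (isotopy_class g).
Proof.
by apply/esym/isotopy_classP; apply: isotopicM; apply/isotopy_classP;
   rewrite isotopy_reprK.
Qed.

Lemma isotopy_class_inv f : isotopy_class f^-1 = mcg_inv (isotopy_class f).
Proof.
by apply/esym/isotopy_classP/isotopicV/isotopy_classP; rewrite isotopy_reprK.
Qed.

Fact mcg_mulA : associative mcg_mul.
Proof.
move=> a b c; rewrite -[a]isotopy_reprK -[b]isotopy_reprK -[c]isotopy_reprK.
by rewrite -!isotopy_class_mul mulgA.
Qed.

Fact mcg_mul1 : left_id (isotopy_class 1) mcg_mul.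
Proof. by move=> a; rewrite -[a]isotopy_reprK -isotopy_class_mul mul1g. Qed.

Fact mcg_mulr1 : right_id (isotopy_class 1) mcg_mul.
Proof. by move=> a; rewrite -[a]isotopy_reprK -isotopy_class_mul mulg1. Qed.

Fact mcg_mulV : left_inverse (isotopy_class 1) mcg_inv mcg_mul.
Proof.
move=> a; rewrite -[a]isotopy_reprK -isotopy_class_inv -isotopy_class_mul.
by rewrite mulVg.
Qed.

Fact mcg_mulrV : right_inverse (isotopy_class 1) mcg_inv mcg_mul.
Proof.
move=> a; rewrite -[a]isotopy_reprK -isotopy_class_inv -isotopy_class_mul.
by rewrite mulgV.
Qed.

HB.instance Definition _ := isGroup.Build mapping_class_group
  mcg_mulA mcg_mul1 mcg_mulr1 mcg_mulV mcg_mulrV.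

End MappingClassGroup.

(* The n marked points are equally spaced on the equator. *)
Definition marked (n : nat) : set sphere :=
  [set x | exists k : 'I_n,
     val x = vec3 (cos (2 * pi * k%:R / n%:R)) (sin (2 * pi * k%:R / n%:R)) 0].

(* Rotation of angle t about the unit vector a (Rodrigues' formula). *)
Definition rotation (a : 'rV[R]_3) (t : R) (x : 'rV[R]_3) : 'rV[R]_3 :=
  cos t *: x + sin t *: cross a x + ((1 - cos t) * dot a x) *: a.

(* The midpoint of the equatorial arc from the k-th to the next marked point. *)
Definition arc_midpoint (n k : nat) : 'rV[R]_3 :=
  vec3 (cos ((2 * k%:R + 1) * pi / n%:R)) (sin ((2 * k%:R + 1) * pi / n%:R)) 0.

(* The half-twist along this arc. It is the half-turn about the midpoint on the
   cap of angular radius pi / n, whose boundary carries the two endpoints, and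
   the identity outside the cap of angular radius 3 pi / n, whose interior
   contains no other marked point. *)
Definition half_twist (n k : nat) (x : 'rV[R]_3) : 'rV[R]_3 :=
  let c := arc_midpoint n k in
  let h0 := cos (3 * pi / n%:R) in
  let h1 := cos (pi / n%:R) in
  let s := (dot c x - h0) / (h1 - h0) in
  rotation c (pi * Num.max 0 (Num.min 1 s)) x.

(* The homomorphism which maps each generator sigma_(k+1) to the class of the
   half-twist exchanging the marked points k and k + 1. *)
Definition canonical_hom (n : nat)
    (phi : group_hom (sphere_braid n) (mapping_class_group (marked n))) :
    Prop :=
  forall k : 'I_n.-1, exists2 h : homeo (marked n),
    (forall x, val (h x) = half_twist n k (val x)) &
    phi (sigma k) = isotopy_class h.

End Sphere.

Arguments sphere : clear implicits.
Arguments unit_interval : clear implicits.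
Arguments marked : clear implicits.

(* Main.v *)
From HB Require Import structures.
Require Import Defs.
From mathcomp Require Import all_boot all_order all_algebra zify.
From mathcomp Require Import all_classical reals topology normedtype trigo.

Set Implicit Arguments.
Unset Strict Implicit.
Unset Printing Implicit Defensive.

Import Order.TTheory GRing.Theory Num.Theory.

Local Open Scope classical_set_scope.
Local Open Scope card_scope.
Local Open Scope group_scope.

(** The map phi is an epimorphism whose kernel [{1, x}] has two elements, hence
is finite, torsion and central, and the rest is group theory.

For the Type I statements, being of Type I amounts to having an epimorphism
to the integers with finite kernel: such an epimorphism splits, and the chosen
section acts on the kernel by conjugation ([conj_hom_Z_Aut]).  Composing with
an epimorphism with finite kernel preserves this ([typeI_pullback]).
Conversely, in an internal product F x| Z every torsion element lies in F, so
that the kernel of phi on H is contained in F, and phi(H) is the product of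
phi(F) by the image of the stable letter ([internal_sdprodZ_image]).

For the Type II statements, the integers are replaced by the infinite dihedral
group [dihedral].  If F has index 2 in G1 and in G2, sending the elements of
G1 outside F to one reflection and those of G2 outside F to the adjacent one
defines a homomorphism from G1 *_F G2 to [dihedral] whose kernel is exactly F:
modulo F, every element is an alternating word in two involutions, and a
nonempty alternating word in the two reflections is nontrivial
([dihedral_kernel], [amalgam_dihedral]).  The same argument shows that a group
with an epimorphism p onto [dihedral] with finite kernel is the amalgam, over
ker p, of the preimages of the subgroups generated by the two reflections
([dihedral_typeII]); therefore Type II lifts along phi ([typeII_pullback]).
In the other direction, the kernel of phi is central and [dihedral] has
trivial center, so an element of H in this kernel is sent to 1 in [dihedral]
and belongs to F ([kernel_sub_amalgamated]); this is all that is needed for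
the amalgam of the images to embed ([internal_amalgam_image]). *)

(** * Homomorphisms and subgroups *)

Section HomOf.
Variables (G H : groupType) (f : G -> H) (fM : {morph f : x y / x * y}).

(* The phantom argument lets the instance below be attached to a function
   whose multiplicativity is a hypothesis. *)
Let hom_fun of {morph f : x y / x * y} := f.

Fact hom_fun1 : hom_fun fM 1 = 1.
Proof. by apply: (mulgI (f 1)); rewrite -fM !mulg1. Qed.

HB.instance Definition _ :=
  isUMagmaMorphism.Build G H (hom_fun fM) (conj hom_fun1 fM).

Definition hom_of : group_hom G H := hom_fun fM.

Lemma hom_ofE x : hom_of x = f x. Proof. by []. Qed.

End HomOf.

Lemma isomorphic_sym (G H : groupType) : isomorphic G H -> isomorphic H G.
Proof.
move=> [f [g fK gK]].
have gM : {morph g : x y / x * y}.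
  by move=> x y; apply: (can_inj fK); rewrite gmulfM !gK.
by exists (hom_of gM); exists f.
Qed.

Lemma hom_inj (G H : groupType) (f : group_hom G H) :
  (forall x, f x = 1 -> x = 1) -> injective f.
Proof.
by move=> f1 x y fxy; apply: divg1_eq; apply: f1; rewrite gmulfF fxy mulgV.
Qed.

Lemma inj_surj_bijective (T U : Type) (f : T -> U) :
  injective f -> (forall y, exists x, f x = y) -> bijective f.
Proof.
move=> fI fS; have [g gK] := choice fS.
by exists g => // x; apply: fI; rewrite gK.
Qed.

Section SubgroupClosure.
Variables (G : groupType) (H : subgroup G).

Lemma subgroupV x : carrier H x -> carrier H x^-1.
Proof.
by move=> Hx; rewrite -div1g; apply: subgroupF => //; exact: subgroup1.
Qed.

Lemma subgroupM x y : carrier H x -> carrier H y -> carrier H (x * y).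
Proof. by move=> Hx /subgroupV Hy; rewrite -[y]invgK; exact: subgroupF. Qed.

Lemma subgroup_val (x : H) : carrier H (val x). Proof. exact: set_valP. Qed.

Definition insubg x (Hx : carrier H x) : H := SigSub (mem_set Hx).

Lemma valMg : {morph (val : H -> G) : x y / x * y}.
Proof. exact: gmulfM. Qed.

Lemma val1g : val (1 : H) = 1.
Proof. exact: gmulf1. Qed.

End SubgroupClosure.

Fact comp_homM (G H K : groupType) (g : group_hom H K) (f : group_hom G H) :
  {morph g \o f : x y / x * y}.
Proof. by move=> x y; rewrite /= !gmulfM. Qed.

Definition comp_hom (G H K : groupType) (g : group_hom H K) (f : group_hom G H)
  : group_hom G K := hom_of (comp_homM g f).

Lemma comp_homE (G H K : groupType) (g : group_hom H K) (f : group_hom G H) x :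
  comp_hom g f x = g (f x).
Proof. by []. Qed.

Definition val_hom (G : groupType) (H : subgroup G) : group_hom H G :=
  hom_of (@valMg G H).

Definition full_subgroup (G : groupType) : subgroup G :=
  @Subgroup G [set: G] I (fun _ _ _ _ => I).

(** * Presented groups and amalgams *)

Section Presented.
Variables (X : choiceType) (R : word X -> word X -> Prop) (K : groupType).
Variable g : X -> K.

Definition letter_value (l : X * bool) : K := if l.2 then (g l.1)^-1 else g l.1.
Definition word_value (w : word X) : K := \prod_(l <- w) letter_value l.

Hypothesis gR : forall u v, R u v -> word_value u = word_value v.

(** The universal property of the presentation: an evaluation of words that
respects the relators only depends on the class of the word. *)
Lemma word_value_pres_eq u v : pres_eq R u v -> word_value u = word_value v.
Proof.
elim=> //.
- by move=> x []; rewrite /word_value !big_cons !big_nil /letter_value /=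
    mulg1 ?mulgV ?mulVg.
- by move=> u1 v1 w1 _ -> _ ->.
- by move=> u1 u2 v1 v2 _ e1 _ e2; rewrite /word_value !big_cat /= in e1 e2 *;
    rewrite e1 e2.
Qed.

Definition presented_fun (a : presented R) : K := word_value (word_repr a).

Lemma presented_fun_class w : presented_fun (word_class R w) = word_value w.
Proof. by apply: word_value_pres_eq; exact: word_repr_class. Qed.

Lemma presented_funM : {morph presented_fun : a b / a * b}.
Proof.
move=> a b; rewrite [a * b]/(pres_mul a b) presented_fun_class.
by rewrite /word_value big_cat.
Qed.

Definition presented_hom : group_hom (presented R) K := hom_of presented_funM.

Lemma presented_hom_generator x : presented_hom (generator R x) = g x.
Proof.
rewrite hom_ofE presented_fun_class /word_value big_cons big_nil.
by rewrite /letter_value mulg1.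
Qed.

End Presented.

Section Amalgam.
Variables (F G1 G2 : groupType) (i1 : F -> G1) (i2 : F -> G2).
Local Notation A := (amalgam i1 i2).
Local Notation inl' := (@amalgam_inl F G1 G2 i1 i2).
Local Notation inr' := (@amalgam_inr F G1 G2 i1 i2).

Lemma amalgam_inlM : {morph inl' : x y / x * y}.
Proof.
move=> x y.
rewrite -[RHS](word_class_cat _ [:: (inl x, false)] [:: (inl y, false)]).
by apply/word_classP/pres_sym/pres_rel; constructor.
Qed.

Lemma amalgam_inrM : {morph inr' : x y / x * y}.
Proof.
move=> x y.
rewrite -[RHS](word_class_cat _ [:: (inr x, false)] [:: (inr y, false)]).
by apply/word_classP/pres_sym/pres_rel; constructor.
Qed.

Definition amalgam_homl : group_hom G1 A := hom_of amalgam_inlM.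
Definition amalgam_homr : group_hom G2 A := hom_of amalgam_inrM.

Lemma amalgam_inl1 : inl' 1 = 1.
Proof. by rewrite -[LHS]/(amalgam_homl 1) gmulf1. Qed.

Lemma amalgam_glueE f : inl' (i1 f) = inr' (i2 f).
Proof. by apply/word_classP/pres_rel; constructor. Qed.

(** Inverses of letters need no separate case, because [amalgam_inl] and
[amalgam_inr] are homomorphisms. *)
Lemma amalgam_ind (P : A -> Prop) :
  P 1 -> (forall x a, P a -> P (inl' x * a)) ->
  (forall y a, P a -> P (inr' y * a)) -> forall a, P a.
Proof.
move=> P1 Pl Pr a; rewrite -[a]word_reprK.
elim: (word_repr a) => [//|[z e] w IHw].
rewrite -cat1s word_class_cat.
have -> : word_class (amalgam_rel i1 i2) [:: (z, e)] =
    letter_value (generator (amalgam_rel i1 i2)) (z, e).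
  by case: e => //=; exact: (word_class_inv _ [:: (z, false)]).
rewrite -/((letter_value _ _ : A) * _) /letter_value.
case: e => /=; case: z => [x|y].
- by rewrite -[(generator _ _)^-1](gmulfV amalgam_homl); exact: Pl.
- by rewrite -[(generator _ _)^-1](gmulfV amalgam_homr); exact: Pr.
- exact: Pl.
- exact: Pr.
Qed.

Section AmalgamHom.
Variables (K : groupType) (h1 : group_hom G1 K) (h2 : group_hom G2 K).
Hypothesis h12 : forall f, h1 (i1 f) = h2 (i2 f).

Let h (z : G1 + G2) : K := match z with inl x => h1 x | inr y => h2 y end.

Fact amalgam_hom_rel u v :
  amalgam_rel i1 i2 u v -> word_value h u = word_value h v.
Proof.
by case=> [x y|x y|f]; rewrite /word_value !big_cons !big_nil /letter_value /=
  !mulg1 -?gmulfM ?h12.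
Qed.

Definition amalgam_hom : group_hom A K := presented_hom amalgam_hom_rel.

Lemma amalgam_hom_inl x : amalgam_hom (inl' x) = h1 x.
Proof. exact: presented_hom_generator. Qed.

Lemma amalgam_hom_inr y : amalgam_hom (inr' y) = h2 y.
Proof. exact: presented_hom_generator. Qed.

End AmalgamHom.

Lemma amalgam_hom_ext (K : groupType) (h h' : group_hom A K) :
  (forall x, h (inl' x) = h' (inl' x)) ->
  (forall y, h (inr' y) = h' (inr' y)) -> h =1 h'.
Proof.
move=> hl hr; elim/amalgam_ind => [|x a IHa|y a IHa]; first by rewrite !gmulf1.
  by rewrite !gmulfM hl IHa.
by rewrite !gmulfM hr IHa.
Qed.

End Amalgam.

(** * The infinite dihedral group *)

(** The pair [(k, e)] stands for the affine map x |-> k + x of the integers,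
or x |-> k - x if [e] holds. *)
Definition dihedral : Type := (int * bool)%type.

Section Dihedral.
Local Open Scope ring_scope.

HB.instance Definition _ := Choice.on dihedral.

Definition flip (e : bool) (k : int) : int := if e then - k else k.

Definition dihedral_mul (a b : dihedral) : dihedral :=
  (a.1 + flip a.2 b.1, a.2 (+) b.2).
Definition dihedral_inv (a : dihedral) : dihedral := (- flip a.2 a.1, a.2).

Fact dihedral_mulA : associative dihedral_mul.
Proof.
by move=> [k []] [l []] [m []]; congr pair; rewrite /dihedral_mul /=; lia.
Qed.

Fact dihedral_mul1 : left_id ((0, false) : dihedral) dihedral_mul.
Proof. by move=> [k e]; rewrite /dihedral_mul /= add0r. Qed.

Fact dihedral_mulr1 : right_id ((0, false) : dihedral) dihedral_mul.
Proof. by move=> [k []]; rewrite /dihedral_mul /= ?oppr0 addr0. Qed.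

Fact dihedral_mulV :
  left_inverse ((0, false) : dihedral) dihedral_inv dihedral_mul.
Proof. by move=> [k []]; congr pair; rewrite /dihedral_mul /=; lia. Qed.

Fact dihedral_mulrV :
  right_inverse ((0, false) : dihedral) dihedral_inv dihedral_mul.
Proof. by move=> [k []]; congr pair; rewrite /dihedral_mul /=; lia. Qed.

HB.instance Definition _ := isGroup.Build dihedral
  dihedral_mulA dihedral_mul1 dihedral_mulr1 dihedral_mulV dihedral_mulrV.

(** The reflections x |-> - x and x |-> 1 - x: adjacent mirrors at 0 and 1/2. *)
Definition reflection (b : bool) : dihedral := (b%:Z, true).

Lemma reflection_neq1 b : reflection b <> 1%g.
Proof. by []. Qed.

Lemma reflectionK b : (reflection b * reflection b)%g = 1%g.
Proof. by case: b. Qed.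

(** The product of the two reflections is a unit translation, so they
generate the group. *)
Lemma dihedral_ind (P : dihedral -> Prop) :
  P 1%g -> (forall b a, P a -> P (reflection b * a)%g) -> forall a, P a.
Proof.
move=> P1 Pr.
have Pk k : P (k, false).
  elim/int_ind: k => [//|n Pn|n Pn].
    have := Pr true _ (Pr false _ Pn); congr P; congr pair => /=.
    by rewrite sub0r opprK -intS.
  have := Pr false _ (Pr true _ Pn); congr P; congr pair => /=.
  by rewrite sub0r opprK -intS.
case=> k [] //; have := Pr false _ (Pk (- k)); congr P; congr pair => /=.
by rewrite sub0r opprK.
Qed.

(** Commuting with x |-> - x leaves only the identity and this reflection,
which does not commute with x |-> 1 - x. *)
Lemma dihedral_center a :
  (forall b, commute a (reflection b)) -> a = 1%g.
Proof.
move=> aC; move: (aC false) (aC true); case: a {aC} => k e.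
case: e => kE lE.
  by case: kE lE => kE [lE]; exfalso; lia.
by case: kE => kE; congr pair; lia.
Qed.

Fixpoint alternating (c : bool) (n : nat) : dihedral :=
  if n is m.+1 then (reflection c * alternating (~~ c) m)%g else 1%g.

(** An alternating word of odd length reverses the orientation, one of even
length 2 m > 0 is the translation by m or by - m. *)
Lemma alternating_neq1 c n : (0 < n)%N -> alternating c n <> 1%g.
Proof.
have altE m b : alternating b m =
    ((-1) ^+ (~~ b) * (m./2)%:Z + (b && odd m)%:Z, odd m) :> dihedral.
  elim: m b => [|m IHm] b; first by case: b.
  rewrite [LHS]/= IHm; case: b => /=; congr pair => /=;
   rewrite ?uphalf_half; case: (odd m) => //=; lia.
rewrite altE => n0 -[] e1 e2; move: e1 n0; rewrite e2 -(odd_double_half n) e2.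
by case: c => /=; lia.
Qed.

End Dihedral.

Lemma dihedral_hom_surj (G : groupType) (d : group_hom G dihedral) :
  (forall b, exists x, d x = reflection b) -> forall e, exists x, d x = e.
Proof.
move=> dr; elim/dihedral_ind => [|b _ [x <-]].
  by exists 1; exact: gmulf1.
by have [y <-] := dr b; exists (y * x); exact: gmulfM.
Qed.

(** * Subgroups of index two and amalgams *)

(** The two subgroups [T false] and [T true] play the parts of the factors of
an amalgam over [N].  By induction on a word in [T false] and [T true], every
element is the product of an element of [N] by an alternating word in lifts
[t false] and [t true] of the reflections.  As no nonempty alternating word
dies in [dihedral], the kernel is reduced to [N]. *)
Lemma dihedral_kernel (A : groupType) (d : group_hom A dihedral)
    (T : bool -> subgroup A) (N : subgroup A) :
  (forall u, carrier N u -> d u = 1) ->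
  (forall b, N `<=` T b) ->
  (forall b u, carrier (T b) u -> carrier N u \/ d u = reflection b) ->
  (forall b, exists2 t, carrier (T b) t & d t = reflection b) ->
  (forall P : A -> Prop, P 1 ->
     (forall b u a, carrier (T b) u -> P a -> P (u * a)) -> forall a, P a) ->
  forall a, d a = 1 -> carrier N a.
Proof.
move=> dN NT Td tP gen a.
have /choice[t Tdt] b : exists t, carrier (T b) t /\ d t = reflection b.
  by have [t] := tP b; exists t.
have Tt b : carrier (T b) (t b) by case: (Tdt b).
have dt b : d (t b) = reflection b by case: (Tdt b).
have NTd b u : carrier (T b) u -> d u = 1 -> carrier N u.
  by move=> Tu du; case: (Td b u Tu) => //; rewrite du => /esym/reflection_neq1.
pose alt := fix alt c n : A := if n is m.+1 then t c * alt (~~ c) m else 1.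
have d_alt n c : d (alt c n) = alternating c n.
  elim: n c => [|n IHn] c; first exact: gmulf1.
  by rewrite /= gmulfM dt IHn.
have [u [c [m [Nu ->]]]] : exists u c m, carrier N u /\ a = u * alt c m.
  elim/gen: a => [|b v a Tv [u [c [m [Nu ->]]]]].
    by exists 1, false, 0%N; split; [exact: subgroup1|rewrite mulg1].
  have Tvu : carrier (T b) (v * u) by apply: subgroupM => //; exact: NT Nu.
  case: (Td b _ Tvu) => [Nvu|dvu].
    by exists (v * u), c, m; rewrite mulgA.
  (* If the letter v is not in N, then v u = (v u / t b) * t b, where the
     first factor is in N because d is 1 on it. *)
  have Nw : carrier N (v * u / t b).
    apply: (NTd b); first exact: subgroupF.
    by rewrite gmulfF dvu dt mulgV.
  have Ntt : carrier N (v * u * t b).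
    apply: (NTd b); first exact: subgroupM.
    by rewrite gmulfM dvu dt reflectionK.
  case: m => [|m].
    by exists (v * u / t b), b, 1%N; rewrite /= !mulg1 mulgVK.
  (* Two equal adjacent letters cancel modulo N. *)
  have [cb|cb] := eqVneq c b.
    by exists (v * u * t b), (~~ c), m; rewrite /= cb !mulgA.
  exists (v * u / t b), b, m.+2; split=> //.
  have -> : c = ~~ b by case: (c) (b) cb => [] [].
  by rewrite -[alt b m.+2]/(t b * alt (~~ b) m.+1) !mulgA mulgVK.
rewrite gmulfM dN // mul1g d_alt; case: m => [_|m /alternating_neq1 []//].
by rewrite mulg1.
Qed.

Section IndexTwo.

(** This form of the condition that A has two cosets in B is what makes the map
to a group of order two with kernel A multiplicative. *)
Definition index_two (G : groupType) (B A : set G) : Prop :=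
  (exists2 x, B x & ~ A x) /\
  forall x y, B x -> B y -> ~ A x -> ~ A y -> A (x * y).

Variables (G : groupType) (A B : subgroup G).
Local Notation coset x := [set x * a | a in carrier A].

Lemma coset_eqP x y : coset x = coset y <-> carrier A (x^-1 * y).
Proof.
split=> [e|Axy].
  have : coset y y by exists 1; [exact: subgroup1 | rewrite mulg1].
  by rewrite -e => -[a Aa <-]; rewrite mulKg.
have AVxy : carrier A (y^-1 * x) by have := subgroupV Axy; rewrite invgM invgK.
apply/seteqP; split=> _ [a Aa <-].
  by exists (y^-1 * x * a); [exact: subgroupM | rewrite -mulgA mulVKg].
by exists (x^-1 * y * a); [exact: subgroupM | rewrite -mulgA mulVKg].
Qed.

(** If x and y are outside A, the cosets of x^-1 and y differ from A, hence
coincide when there are only two cosets. *)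
Lemma left_cosets_index_two :
  left_cosets B A #= `I_2 <-> index_two B A.
Proof.
split=> [/card_set_bijP[f [fI finj fsurj]]|[[x Bx nAx] BA]].
- have fcoset x : carrier B x -> (f (coset x) < 2)%N.
    by move=> Bx; apply: (fI); exists x.
  have fcosetI x y : carrier B x -> carrier B y ->
      f (coset x) = f (coset y) -> carrier A (x^-1 * y).
    move=> Bx By fxy; apply/coset_eqP; apply: finj => //; apply/mem_set;
    by [exists x | exists y].
  have B1 := subgroup1 B.
  split.
    have [_ [x Bx <-] fx] := fsurj 0%N isT.
    have [_ [y By <-] fy] := fsurj 1%N isT.
    have [Ax|] := pselect (carrier A x); last by exists x.
    exists y => // Ay.
    suff e : coset x = coset y by move: fx; rewrite e fy.
    by apply/coset_eqP; apply: subgroupM => //; exact: subgroupV.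
  move=> x y Bx By nAx nAy; have BVx := subgroupV Bx.
  rewrite -[x]invgK; apply: (fcosetI) => //.
  have := fcoset _ B1; have := fcoset _ BVx; have := fcoset _ By.
  have : f (coset 1) <> f (coset y).
    by move=> /fcosetI-/(_ B1 By); rewrite invg1 mul1g.
  have : f (coset x^-1) <> f (coset 1).
    by move=> /fcosetI-/(_ BVx B1); rewrite invgK mulg1.
  (* Three values in {0, 1}, the middle one differing from both others. *)
  by move: (f (coset x^-1)) (f (coset 1)) (f (coset y))
    => [|[|?]] [|[|?]] [|[|?]] /=; lia.
- apply/card_set_bijP.
  have n1x : coset 1 <> coset x by move/coset_eqP; rewrite invg1 mul1g.
  have cosetE y : carrier B y -> coset y <> coset 1 -> coset y = coset x.
    move=> By ny1; apply/coset_eqP; apply: BA => //; first exact: subgroupV.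
    move/(@subgroupV _ A); rewrite invgK => Ay; apply: ny1; apply/coset_eqP.
    by rewrite mulg1; exact: subgroupV.
  exists (fun c => if pselect (c = coset 1) then 0%N else 1%N); split.
  + by move=> c _; case: pselect.
  + move=> _ _ /set_mem[y By <-] /set_mem[z Bz <-].
    case: pselect => yE; case: pselect => zE //= _; first by rewrite yE zE.
    by rewrite (cosetE y) // (cosetE z).
  + move=> [|[|//]] _.
      exists (coset 1); first by exists 1 => //; exact: subgroup1.
      by case: pselect.
    exists (coset x); first by exists x.
    by case: pselect => // e; case: n1x.
Qed.

End IndexTwo.

Lemma range_inclusion (G : groupType) (A B : subgroup G) (s : A `<=` B)
    (x : B) :
  range (inclusion s) x <-> carrier A (val x).
Proof.
split=> [[a _ <-]|Ax]; first exact: subgroup_val.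
by exists (insubg Ax) => //; apply: val_inj.
Qed.

Lemma index_two_inclusion (G : groupType) (A B : subgroup G) (s : A `<=` B) :
  index_two B A -> index_two [set: B] (range (inclusion s)).
Proof.
move=> [[x Bx nAx] BA]; split.
  by exists (insubg Bx) => // /range_inclusion.
move=> y z _ _ ny nz; apply/range_inclusion; rewrite valMg.
by apply: BA; try exact: subgroup_val; move=> /(range_inclusion s).
Qed.

(** The quotient by a subgroup of index two, realized by an involution of
[dihedral]. *)
Lemma index_two_sign (G : groupType) (A : subgroup G) (r : dihedral) :
  r * r = 1 -> index_two [set: G] A ->
  exists h : group_hom G dihedral,
    forall x, carrier A x /\ h x = 1 \/ ~ carrier A x /\ h x = r.
Proof.
move=> rr [_ BA]; pose h x := if pselect (carrier A x) then 1 else r.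
have hM : {morph h : x y / x * y}.
  move=> x y; rewrite /h.
  case: pselect => [Axy|nAxy]; case: pselect => [Ax|nAx];
    case: pselect => [Ay|nAy]; rewrite ?mulg1 ?mul1g ?rr //.
  - case: nAy; rewrite -(mulKg x y).
    by apply: subgroupM => //; exact: subgroupV.
  - case: nAx; rewrite -(mulgK y x).
    by apply: subgroupM => //; exact: subgroupV.
  - by case: nAxy; exact: subgroupM.
  - by case: nAxy; exact: BA.
exists (hom_of hM) => x; rewrite hom_ofE /h.
by case: pselect => Ax; [left | right].
Qed.

Section AmalgamDihedral.
Variables (F G1 G2 : groupType) (i1 : group_hom F G1) (i2 : group_hom F G2).
Local Notation A := (amalgam i1 i2).
Local Notation inl' := (amalgam_inl i1 i2).
Local Notation inr' := (amalgam_inr i1 i2).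

(** Stated for any [d] with the expected values on the factors: it is applied
both to the homomorphism built from the indices and to the restriction of a
given epimorphism onto [dihedral]. *)
Lemma amalgam_dihedral_kernel (d : group_hom A dihedral) :
  (exists x, d (inl' x) = reflection false) ->
  (exists y, d (inr' y) = reflection true) ->
  (forall f, d (inl' (i1 f)) = 1) ->
  (forall x, range i1 x \/ d (inl' x) = reflection false) ->
  (forall y, range i2 y \/ d (inr' y) = reflection true) ->
  forall a, d a = 1 -> exists f, a = inl' (i1 f).
Proof.
move=> [x0 dx0] [y0 dy0] dF dl dr a da.
pose N := image_subgroup (comp_hom (amalgam_homl i1 i2) i1) (full_subgroup F).
pose T b := if b then image_subgroup (amalgam_homr i1 i2) (full_subgroup G2)
            else image_subgroup (amalgam_homl i1 i2) (full_subgroup G1).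
suff [f _ <-] : carrier N a by exists f.
apply: (@dihedral_kernel _ d T N) => // {a da}.
- by move=> _ [f _ <-]; exact: dF.
- move=> [] _ [f _ <-]; last by exists (i1 f).
  by exists (i2 f) => //; exact/esym/amalgam_glueE.
- move=> [] _ [x _ <-].
    case: (dr x) => [[f _ <-]|?]; last by right.
    by left; exists f => //; exact: amalgam_glueE.
  by case: (dl x) => [[f _ <-]|?]; [left; exists f | right].
- move=> [].
    by exists (inr' y0) => //; exists y0.
  by exists (inl' x0) => //; exists x0.
- move=> P P1 Pm; elim/amalgam_ind => // x a Pa.
    by apply: (Pm false) => //; exists x.
  by apply: (Pm true) => //; exists x.
Qed.

Lemma amalgam_dihedral :
  index_two [set: G1] (range i1) -> index_two [set: G2] (range i2) ->
  exists d : group_hom A dihedral,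
    (forall b, exists a, d a = reflection b) /\
    forall a, d a = 1 -> exists f, a = inl' (i1 f).
Proof.
move=> ind1 ind2.
have [h1 h1E] := @index_two_sign _ (image_subgroup i1 (full_subgroup F)) _
  (reflectionK false) ind1.
have [h2 h2E] := @index_two_sign _ (image_subgroup i2 (full_subgroup F)) _
  (reflectionK true) ind2.
have h1F f : h1 (i1 f) = 1 by case: (h1E (i1 f)) => [[]//|[[]]]; exists f.
have h2F f : h2 (i2 f) = 1 by case: (h2E (i2 f)) => [[]//|[[]]]; exists f.
have h12 f : h1 (i1 f) = h2 (i2 f) by rewrite h1F h2F.
pose d := amalgam_hom h12.
have dl x : d (inl' x) = h1 x by exact: amalgam_hom_inl.
have dr y : d (inr' y) = h2 y by exact: amalgam_hom_inr.
have [x0 dx0] : exists x, d (inl' x) = reflection false.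
  by case: ind1 => -[x _ nx] _; exists x; rewrite dl; case: (h1E x) => -[].
have [y0 dy0] : exists y, d (inr' y) = reflection true.
  by case: ind2 => -[y _ ny] _; exists y; rewrite dr; case: (h2E y) => -[].
exists d; split; first by case; [exists (inr' y0) | exists (inl' x0)].
apply: amalgam_dihedral_kernel.
- by exists x0.
- by exists y0.
- by move=> f; rewrite dl.
- by move=> x; rewrite dl; case: (h1E x) => -[]; [left | right].
- by move=> y; rewrite dr; case: (h2E y) => -[]; [left | right].
Qed.

End AmalgamDihedral.

(** * Epimorphisms with finite kernel *)

Section IntegerPowers.
Variables (G : groupType) (x : G).

Definition zpow (k : int) : G :=
  match k with Posz n => x ^+ n | Negz n => x ^- n.+1 end.

Lemma zpowS k : zpow (1 + k)%R = x * zpow k.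
Proof.
case: k => [n|[|n]].
- by rewrite /= expgS.
- by rewrite /= mulgV.
have -> : (1 + Negz n.+1 = Negz n)%R by lia.
by rewrite -[RHS]/(x / x ^+ n.+2) (expgSr x n.+1) invgM mulVKg.
Qed.

Lemma zpowD k l : zpow (k + l)%R = zpow k * zpow l.
Proof.
elim/int_ind: k => [|n IHn|n IHn]; first by rewrite add0r mul1g.

  by rewrite intS -addrA !zpowS IHn mulgA.
apply: (mulgI x); rewrite mulgA -!zpowS.
have -> : (1 + (- n.+1%:Z + l) = - n%:Z + l)%R by lia.
by have -> : (1 - n.+1%:Z = - n%:Z)%R by lia.
Qed.

Lemma cyclic_setE : cyclic_set x = range zpow.
Proof.
apply/seteqP; split=> [_ [n [->|->]]|_ [[n|n] _ <-]].
- by exists (Posz n).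
- by case: n => [|n]; [exists 0%R => //=; rewrite invg1 | exists (Negz n)].
- by exists n; left.
- by exists n.+1; right.
Qed.

End IntegerPowers.

Section FiniteKernel.
Variables (G K : groupType) (pi : group_hom G K).
Hypotheses (pi_surj : forall y, exists x, pi x = y)
  (pi_ker : finite_set [set x | pi x = 1]).

(** Each fibre is a coset of the kernel. *)
Lemma finite_preimage_hom (S : set K) : finite_set S -> finite_set (pi @^-1` S).
Proof.
move=> finS; have [s sK] := choice pi_surj.
apply: (@sub_finite_set _ _
  (\bigcup_(y in S) [set s y * z | z in [set x | pi x = 1]])).
  move=> x Sx; exists (pi x) => //; exists ((s (pi x))^-1 * x).
    by rewrite /= gmulfM gmulfV sK mulVg.
  by rewrite mulVKg.
by apply: bigcup_finite => // y _; exact: finite_image.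
Qed.

Lemma infinite_pullback : infinite_set [set: K] -> infinite_set [set: G].
Proof.
move=> infK /(finite_image pi) finG; apply: infK; apply: sub_finite_set finG.
by move=> y _; have [x <-] := pi_surj y; exists x.
Qed.

(** A lift [x] of the cyclic generator [y] works.  Choosing one element in each
coset of [y], every coset of [x] meets the preimage of the finite set of
chosen elements, which is finite. *)
Lemma virtually_cyclic_pullback : virtually_cyclic K -> virtually_cyclic G.
Proof.
move=> [y fin]; have [x xy] := pi_surj y; exists x.
pose rep (c : set K) := xget 1 c.
have finR := finite_preimage_hom (finite_image rep fin).
apply: sub_finite_set
  (finite_image (fun r => [set r * a | a in cyclic_set x]) finR).
move=> _ [g _ <-].
pose c := [set pi g * a | a in cyclic_set y].
have [k gk] : exists k, rep c = pi (g * zpow x k).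
  have : exists z, c z.
    exists (pi g), 1; rewrite ?mulg1 //.
    by exists 0%N; left.
  move=> /(xgetPex 1); rewrite -/(rep c) => -[z].
  rewrite cyclic_setE => -[k _ <-] <-.
  exists k; rewrite gmulfM -xy; congr (_ * _).
  by case: k => n; rewrite /zpow ?gmulfV gmulfXn.
exists (g * zpow x k).
  by rewrite /preimage /= -gk; exists c => //; exists (pi g).
rewrite cyclic_setE; apply/seteqP; split=> _ [_ [l _ <-] <-].
  by exists (zpow x (k + l)%R); [exists (k + l)%R | rewrite zpowD mulgA].
exists (zpow x (- k + l)%R); first by exists (- k + l)%R.
by rewrite -mulgA -zpowD addrA subrr add0r.
Qed.

End FiniteKernel.

(** * Groups of Type I *)

Section ConjugationAction.
Variables (G : groupType) (F : subgroup G) (T : int -> G).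
Hypothesis TD : forall k l, T (k + l)%R = T k * T l.
Hypothesis TF : forall k x, carrier F x -> carrier F (T k * x * (T k)^-1).

Definition conj_act (k : int) (x : F) : F := insubg (TF k (subgroup_val x)).

Lemma val_conj_act k x : val (conj_act k x) = T k * val x * (T k)^-1.
Proof. by []. Qed.

Lemma conj_actM k : {morph conj_act k : x y / x * y}.
Proof.
by move=> x y; apply: val_inj; rewrite valMg !val_conj_act valMg !mulgA mulgVK.
Qed.

Lemma conj_actD k l : conj_act (k + l)%R =1 conj_act k \o conj_act l.
Proof.
by move=> x; apply: val_inj; rewrite /= TD invgM !mulgA.
Qed.

Lemma conj_act_bij k : bijective (conj_act k).
Proof.
have T0 : T 0%R = 1 by apply: (mulgI (T 0%R)); rewrite -TD addr0 mulg1.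
have act0 x : conj_act 0%R x = x.
  by apply: val_inj; rewrite val_conj_act T0 divg1 mul1g.
exists (conj_act (- k)%R) => x.
  by have := conj_actD (- k)%R k x; rewrite addNr act0.
by have := conj_actD k (- k)%R x; rewrite addrN act0.
Qed.

Definition conj_hom_Z_Aut : hom_Z_Aut F :=
  HomZAut conj_act_bij conj_actM conj_actD.

Definition sdprodZ_fun (a : sdprodZ conj_hom_Z_Aut) : G := val a.1 * T a.2.

Lemma sdprodZ_funM : {morph sdprodZ_fun : a b / a * b}.
Proof.
move=> [x k] [y l]; rewrite /sdprodZ_fun /= TD.
by rewrite !mulgA mulgVK.
Qed.

End ConjugationAction.

Section FiniteKernelTypes.
Variables (G K : groupType) (pi : group_hom G K).
Hypotheses (pi_surj : forall y, exists x, pi x = y)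
  (pi_ker : finite_set [set x | pi x = 1]).

(** Let p : G -> Z be the composition of pi with the projection of K to the
integers.  Its kernel F is finite, and the powers of an element t with
p(t) = 1 give the section needed to write G as F x| Z. *)
Lemma typeI_pullback : typeI K -> typeI G.
Proof.
move=> [infK vcK [F' [theta [finF' [f [g fK gK]]]]]]; split.
- exact: infinite_pullback infK.
- exact: virtually_cyclic_pullback vcK.
pose p x := (f (pi x)).2.
have pM x y : p (x * y) = (p x + p y)%R by rewrite /p !gmulfM.
have p1 : p 1 = 0%R by rewrite /p !gmulf1.
have pV x : p x^-1 = (- p x)%R by rewrite /p !gmulfV.
have [t pt] : exists t, p t = 1%R.
  have [t tE] := pi_surj (g ((1, 1%R) : sdprodZ theta)).
  by exists t; rewrite /p tE gK.
have pT k : p (zpow t k) = k.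
  elim/int_ind: k => [//|n IHn|n IHn]; first by rewrite intS zpowS pM pt IHn.
  apply: (addrI 1%R); rewrite -{1}pt -pM -zpowS.
  have -> : (1 - n.+1%:Z = - n%:Z)%R by lia.
  by rewrite IHn.
have pF x y : p x = 0%R -> p y = 0%R -> p (x / y) = 0%R.
  by move=> px py; rewrite pM pV px py subr0.
pose F := @Subgroup G [set x | p x = 0%R] p1 pF.
have TF k x : carrier F x -> carrier F (zpow t k * x * (zpow t k)^-1).
  by rewrite /= !pM pV => ->; rewrite addr0 subrr.
have fM := @sdprodZ_funM _ _ _ (zpowD t) TF.
exists F, (conj_hom_Z_Aut (zpowD t) TF); split.
  apply: (@sub_finite_set _ _ (val @^-1` [set x | p x = 0%R])).
    by move=> x _; exact: (subgroup_val x).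
  apply: finite_preimage; first by move=> x y _ _; exact: val_inj.
  apply: (@sub_finite_set _ _ (pi @^-1` [set g (x, 0%R) | x in [set: F']])).
    move=> x /= px; exists (f (pi x)).1 => //.
    by rewrite -[RHS]fK; congr g; rewrite [RHS]surjective_pairing -px.
  exact/finite_preimage_hom/finite_image.
apply: isomorphic_sym; exists (hom_of fM); apply: inj_surj_bijective.
  apply: hom_inj => -[x k]; rewrite hom_ofE /sdprodZ_fun /= => xk.
  have k0 : k = 0%R.
    by have := congr1 p xk; rewrite pM pT p1 (subgroup_val x) add0r.
  by congr pair => //; apply: val_inj; rewrite val1g -xk k0 mulg1.
move=> x.
have Fx : carrier F (x * (zpow t (p x))^-1) by rewrite /= pM pV pT subrr.
by exists (insubg Fx, p x); rewrite hom_ofE /sdprodZ_fun /= mulgVK.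
Qed.

End FiniteKernelTypes.

(** * Groups of Type II *)

(** The kernel of the map to [dihedral] is the amalgamated subgroup, which is
finite. *)
Lemma typeII_dihedral (G : groupType) : typeII G ->
  exists2 d : group_hom G dihedral,
    forall b, exists x, d x = reflection b & finite_set [set x | d x = 1].
Proof.
move=> [_ _ [F [G1 [G2 [i1 [i2 [[finF _] _ [ind1 ind2] [f fbij]]]]]]]].
have [d [dr dker]] := amalgam_dihedral
  ((@left_cosets_index_two _ (image_subgroup i1 (full_subgroup F))
      (full_subgroup G1)).1 ind1)
  ((@left_cosets_index_two _ (image_subgroup i2 (full_subgroup F))
      (full_subgroup G2)).1 ind2).
case: fbij (fbij) => g fK gK /bij_inj finj.
exists (comp_hom d f).
  by move=> b; have [a da] := dr b; exists (g a); rewrite comp_homE gK.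
apply: (@sub_finite_set _ _
  (f @^-1` [set amalgam_inl i1 i2 (i1 x) | x in [set: F]])).
  by move=> x /dker[y fx]; exists y.
by apply: finite_preimage; [move=> x y _ _; exact: finj | exact: finite_image].
Qed.

(** The factors are the preimages of the two subgroups generated by a
reflection; they meet in the kernel F of p, which has index two in both.  The
map h from their amalgam to G is onto because the reflections generate
[dihedral].  It is injective because an element killed by h is killed by
p o h, hence belongs to F, on which h is the inclusion. *)
Lemma dihedral_typeII (G : groupType) (p : group_hom G dihedral) :
  infinite_set [set: G] -> virtually_cyclic G ->
  (forall b, exists x, p x = reflection b) -> finite_set [set x | p x = 1] ->
  typeII G.
Proof.
move=> infG vcG pr finp; split=> //.
have psurj := dihedral_hom_surj pr.
have F1 : [set x | p x = 1] 1 by exact: gmulf1.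
have FF x y : p x = 1 -> p y = 1 -> p (x / y) = 1.
  by move=> px py; rewrite gmulfF px py mulgV.
pose F := Subgroup F1 FF.
pose S b := [set x | p x = 1 \/ p x = reflection b].
have S1 b : S b 1 by left; exact: gmulf1.
have SF b x y : S b x -> S b y -> S b (x / y).
  have rV : (reflection b)^-1 = reflection b.
    by apply: mulg1_eq; exact: reflectionK.
  rewrite /S /= gmulfF => -[] -> -[] ->;
    rewrite ?rV ?reflectionK ?mulgV ?divg1 ?mul1g;
    by [left | right].
pose Gb b := Subgroup (S1 b) (@SF b).
have sub b : F `<=` Gb b by move=> x px; left.
have finS b : finite_set [set: Gb b].
  apply: (@sub_finite_set _ _ (val @^-1` S b)).
    by move=> x _; exact: (subgroup_val x).
  apply: finite_preimage; first by move=> x y _ _; exact: val_inj.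
  exact: (finite_preimage_hom psurj finp (finite_set2 1 (reflection b))).
have ind b : index_two (Gb b) F.
  split.
    by have [x px] := pr b; exists x; [right | rewrite /= px].
  by move=> x y /= [] // px [] // py _ _; rewrite gmulfM px py reflectionK.
exists F, (Gb false), (Gb true).
exists (inclusion (sub false)), (inclusion (sub true)).
split.
- split; last by split; exact: finS.
  apply: (@sub_finite_set _ _ (val @^-1` [set x | p x = 1])).
    by move=> x _; exact: (subgroup_val x).
  by apply: finite_preimage => // x y _ _; exact: val_inj.
- by split=> x y /(congr1 val) xy; apply: val_inj.
- split.
    apply/(@left_cosets_index_two _ (image_subgroup (inclusion (sub false))
      (full_subgroup F)) (full_subgroup _)).
    exact: index_two_inclusion.
  apply/(@left_cosets_index_two _ (image_subgroup (inclusion (sub true))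
      (full_subgroup F)) (full_subgroup _)).
  exact: index_two_inclusion.
have h12 (x : F) : val_hom _ (inclusion (sub false) x) =
    val_hom _ (inclusion (sub true) x) by [].
pose h := amalgam_hom h12.
have hl x : h (amalgam_inl _ _ x) = val x by exact: amalgam_hom_inl.
have hr x : h (amalgam_inr _ _ x) = val x by exact: amalgam_hom_inr.
apply: isomorphic_sym; exists h; apply: inj_surj_bijective.
  apply: hom_inj => a ha.
  have Gr b : exists x : Gb b, p (val x) = reflection b.
    have [x px] := pr b; have Sx : carrier (Gb b) x by right.
    by exists (insubg Sx).
  have Gd b (x : Gb b) :
      range (inclusion (sub b)) x \/ p (val x) = reflection b.
    by case: (subgroup_val x) => px; [left; apply/range_inclusion | right].
  have [x aE] : exists x, a = amalgam_inl _ _ (inclusion (sub false) x).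
    have dl y : comp_hom p h (amalgam_inl _ _ y) = p (val y).
      exact: (congr1 p (hl y)).
    have dr' y : comp_hom p h (amalgam_inr _ _ y) = p (val y).
      exact: (congr1 p (hr y)).
    apply: (@amalgam_dihedral_kernel _ _ _ _ _ (comp_hom p h)).
    - by have [x px] := Gr false; exists x; rewrite dl.
    - by have [x px] := Gr true; exists x; rewrite dr'.
    - by move=> x; rewrite dl; exact: (subgroup_val x).
    - by move=> x; rewrite dl; exact: Gd.
    - by move=> x; rewrite dr'; exact: Gd.
    - by rewrite comp_homE ha gmulf1.
  have x1 : x = 1 by apply: val_inj; rewrite val1g -ha aE hl.
  rewrite aE x1 [inclusion _ _]gmulf1.
  exact: amalgam_inl1.
have Gh b (x : Gb b) : exists a, h a = val x.
  case: b x => x; first by exists (amalgam_inr _ _ x); exact: hr.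
  by exists (amalgam_inl _ _ x); exact: hl.
(* Lift a word in the reflections representing p x, letter by letter. *)
suff hp e : forall x, p x = e -> exists a, h a = x by move=> x; exact: hp.
elim/dihedral_ind: e => [|b e IHe] x px.
  have Fx : carrier (Gb false) x by left.
  by have [a ha] := Gh _ (insubg Fx); exists a.
have [r pr_r] := pr b; have Sr : carrier (Gb b) r by right.
have [a ha] : exists a, h a = r^-1 * x.
  by apply: IHe; rewrite gmulfM gmulfV pr_r px mulKg.
have [c hc] := Gh _ (insubg Sr); exists (c * a).
by rewrite gmulfM hc ha /= mulVKg.
Qed.

Lemma typeII_pullback (G K : groupType) (pi : group_hom G K) :
  (forall y, exists x, pi x = y) -> finite_set [set x | pi x = 1] ->
  typeII K -> typeII G.
Proof.
move=> pi_surj pi_ker tK; have [infK vcK _] := tK.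
have [d dr dker] := typeII_dihedral tK.
apply: (@dihedral_typeII _ (comp_hom d pi)).
- exact: infinite_pullback infK.
- exact: virtually_cyclic_pullback vcK.
- move=> b; have [y dy] := dr b; have [x xy] := pi_surj y.
  by exists x; rewrite comp_homE xy.
- exact: (finite_preimage_hom pi_surj pi_ker dker).
Qed.

(** * Preimages and images of subgroups *)

Section Images.
Variables (G K : groupType) (phi : group_hom G K).

Section Restriction.
Variable H' : subgroup K.

Definition restrict (x : preimage_subgroup phi H') : H' :=
  @insubg K H' (phi (val x)) (subgroup_val x).

Lemma restrictM : {morph restrict : x y / x * y}.
Proof. by move=> x y; apply: val_inj; rewrite valMg /= gmulfM. Qed.

Definition restrict_hom : group_hom (preimage_subgroup phi H') H' :=
  hom_of restrictM.

Lemma restrict_surj : (forall y, exists x, phi x = y) ->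
  forall y, exists x, restrict_hom x = y.
Proof.
move=> phi_surj y; have [x xy] := phi_surj (val y).
have Hx : carrier (preimage_subgroup phi H') x.
  by rewrite /= /preimage /= xy; exact: subgroup_val.
by exists (insubg Hx); apply: val_inj.
Qed.

Lemma restrict_ker : finite_set [set x | phi x = 1] ->
  finite_set [set x | restrict_hom x = 1].
Proof.
move=> fin; apply: (@sub_finite_set _ _ (val @^-1` [set x | phi x = 1])).
  by move=> x /(congr1 val); rewrite val1g.
by apply: finite_preimage => // x y _ _; exact: val_inj.
Qed.

End Restriction.

(** With t(k) in H the element corresponding to (1, k), theta(k) is the
conjugation by t(k), so theta'(k) has to be the conjugation by phi(t(k)).  The
product stays semidirect because an element x t(k) of the kernel of phi is
torsion, which forces k = 0. *)
Lemma internal_sdprodZ_image (H F : subgroup G) (theta : hom_Z_Aut F) :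
  (forall z, phi z = 1 -> exists2 m, (0 < m)%N & z ^+ m = 1) ->
  internal_sdprodZ H theta ->
  exists theta' : hom_Z_Aut (image_subgroup phi F),
    (forall k (f' : image_subgroup phi F) (f : F),
        phi (val f) = val f' -> val (theta' k f') = phi (val (theta k f))) /\
    internal_sdprodZ (image_subgroup phi H) theta'.
Proof.
move=> tors [f [g fK gK] fF].
pose s k : sdprodZ theta := (1, k).
pose t k := val (f (s k)).
have fE x k : val (f (x, k)) = val x * t k.
  have -> : (x, k) = ((x, 0%R) : sdprodZ theta) * s k.
    by congr pair; rewrite ?zact1 ?mulg1 ?add0r.
  by rewrite gmulfM valMg fF.
have tD k l : t (k + l)%R = t k * t l.
  have sD : s (k + l)%R = s k * s l by congr pair; rewrite zact1 mulg1.
  by rewrite /t sD gmulfM valMg.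
have thetat k x : val (theta k x) * t k = t k * val x.
  rewrite -fE -fF -valMg -gmulfM; congr (val (f _)).
  by congr pair; rewrite ?mul1g ?addr0.
pose T k := phi (t k).
have TD k l : T (k + l)%R = T k * T l by rewrite /T tD gmulfM.
have thetaT k x : phi (val (theta k x)) = T k * phi (val x) * (T k)^-1.
  by rewrite /T -[phi (t k) * _]gmulfM -thetat gmulfM mulgK.
have TF k y : carrier (image_subgroup phi F) y ->
    carrier (image_subgroup phi F) (T k * y * (T k)^-1).
  move=> [x Fx <-]; exists (val (theta k (insubg Fx))).
    exact: subgroup_val.
  exact: thetaT.
exists (conj_hom_Z_Aut TD TF); split.
  by move=> k f' x xf'; rewrite thetaT xf'.
have FH x : carrier F x -> carrier H x.
  by move=> Fx; rewrite -[x]/(val (insubg Fx)) -fF; exact: subgroup_val.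
have imH (a : sdprodZ (conj_hom_Z_Aut TD TF)) :
    carrier (image_subgroup phi H) (sdprodZ_fun a).
  apply: subgroupM; last by exists (t a.2) => //; exact: subgroup_val.
  by have [x Fx <-] := subgroup_val a.1; exists x => //; exact: FH.
pose h a := insubg (imH a).
have hM : {morph h : a b / a * b}.
  by move=> a b; apply: val_inj; rewrite valMg; exact: sdprodZ_funM.
have t0 : t 0%R = 1 by apply: (mulgI (t 0%R)); rewrite -tD addr0 mulg1.
have T0 : T 0%R = 1 by rewrite /T t0 gmulf1.
exists (hom_of hM); last first.
  by move=> x; rewrite hom_ofE /= /sdprodZ_fun /= T0 mulg1.
have ker_phi k (x : F) : phi (val x * t k) = 1 -> k = 0%R.
  move=> /tors[m m0]; rewrite -fE -[val _ ^+ m](gmulfXn (val_hom H)) -gmulfXn.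
  move=> xk1; have {xk1} : ((x, k) : sdprodZ theta) ^+ m = 1.
    by apply: (can_inj fK); apply: val_inj; rewrite gmulf1 val1g.
  have powE l : (((x, k) : sdprodZ theta) ^+ l).2 = (k *+ l)%R.
    by elim: l => // l IHl; rewrite expgS mulrS -IHl.
  move=> /(congr1 snd); rewrite powE => /eqP.
  by rewrite mulrn_eq0 => /orP[|/eqP//]; rewrite eqn0Ngt m0.
apply: inj_surj_bijective.
  apply: hom_inj => -[y k] /(congr1 val).
  rewrite val1g /= /sdprodZ_fun /= => yk.
  have [x Fx xy] := subgroup_val y.
  have k0 : k = 0%R.
    by apply: (ker_phi k (insubg Fx)); rewrite /= gmulfM xy.
  by congr pair => //; apply: val_inj; rewrite val1g -yk k0 T0 mulg1.
move=> y; have [x Hx xy] := subgroup_val y.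
case e : (g (insubg Hx)) => [z k].
have xE : x = val z * t k by rewrite -fE -e gK.
have Fz : carrier (image_subgroup phi F) (phi (val z)).
  by exists (val z) => //; exact: subgroup_val.
exists (insubg Fz, k); apply: val_inj.
by rewrite hom_ofE /= /sdprodZ_fun /= -gmulfM -xE.
Qed.

(** A central element of H has central image in [dihedral], hence trivial
image, hence belongs to the kernel F of the map to [dihedral]. *)
Lemma kernel_sub_amalgamated (H G1 G2 F : subgroup G) :
  (forall z x, phi z = 1 -> commute z x) ->
  internal_amalgam H G1 G2 F -> index_two G1 F -> index_two G2 F ->
  forall z, carrier H z -> phi z = 1 -> carrier F z.
Proof.
move=> central [_ [s1 [s2 [f [[g fK gK] fl fr]]]]] ind1 ind2 z Hz phiz.
have [d [dr dker]] := amalgam_dihedral (index_two_inclusion s1 ind1)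
  (index_two_inclusion s2 ind2).
have [x gz] : exists x, g (insubg Hz) = amalgam_inl _ _ (inclusion s1 x).
  apply: dker; apply: dihedral_center => b; have [a <-] := dr b.
  apply: gmulf_commute; apply: (can_inj fK); rewrite !gmulfM gK.
  by apply: val_inj; rewrite !valMg; exact: central.
have -> : z = val x by rewrite -[z]/(val (insubg Hz)) -(gK (insubg Hz)) gz fl.
exact: subgroup_val.
Qed.

(** Let q be the map from G1 *_F G2 to the amalgam of the images, and h the map
from the latter to phi(H).  Since q is onto, an element killed by h lifts to an
element of H killed by phi.  This lift belongs to F, and on F the map q is phi
followed by the inclusion of phi(F). *)
Lemma internal_amalgam_image (H G1 G2 F : subgroup G) :
  (forall z x, phi z = 1 -> commute z x) ->
  internal_amalgam H G1 G2 F -> index_two G1 F -> index_two G2 F ->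
  internal_amalgam (image_subgroup phi H) (image_subgroup phi G1)
    (image_subgroup phi G2) (image_subgroup phi F).
Proof.
move=> central amH ind1 ind2.
have kerF := kernel_sub_amalgamated central amH ind1 ind2.
have [FE [s1 [s2 [f [[g fK gK] fl fr]]]]] := amH.
have HG1 : G1 `<=` H.
  by move=> x Gx; rewrite -[x]/(val (insubg Gx)) -fl; exact: subgroup_val.
have HG2 : G2 `<=` H.
  by move=> x Gx; rewrite -[x]/(val (insubg Gx)) -fr; exact: subgroup_val.
split.
  (* If phi x1 = phi x2, then x1 and x2 differ by an element of the kernel,
     which is in F. *)
  apply/seteqP; split=> [_ [x Fx <-]|y [[x1 G1x1 <-] [x2 G2x2 x21]]].
    by split; exists x => //; [exact: (s1) | exact: (s2)].
  have G12 : carrier F (x2^-1 * x1).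
    apply: kerF; last by rewrite gmulfM gmulfV x21 mulVg.
    by apply: subgroupM; [apply: subgroupV; exact: HG2 | exact: HG1].
  exists x1 => //; rewrite FE; split=> //.
  by rewrite -(mulVKg x2 x1); apply: subgroupM => //; exact: (s2).
have im (A B : subgroup G) (s : A `<=` B) :
  image_subgroup phi A `<=` image_subgroup phi B by exact: image_subset.
exists (im _ _ s1), (im _ _ s2).
have h12 y : inclusion (im _ _ HG1) (inclusion (im _ _ s1) y) =
    inclusion (im _ _ HG2) (inclusion (im _ _ s2) y) by exact: val_inj.
pose h := amalgam_hom h12.
have hl y : h (amalgam_inl _ _ y) = inclusion (im _ _ HG1) y.
  exact: amalgam_hom_inl.
have hr y : h (amalgam_inr _ _ y) = inclusion (im _ _ HG2) y.
  exact: amalgam_hom_inr.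
have imP (A : subgroup G) (x : A) :
    carrier (image_subgroup phi A) (phi (val x)).
  by exists (val x) => //; exact: subgroup_val.
have cM (A : subgroup G) :
    {morph (fun x : A => insubg (imP A x)) : x y / x * y}.
  move=> x y; apply: val_inj; rewrite [RHS]valMg.
  have phiM : phi (val (x * y)) = phi (val x) * phi (val y).
    by rewrite valMg gmulfM.
  exact: phiM.
pose c A := hom_of (cM A).
have c12 x :
    comp_hom (amalgam_homl (inclusion (im _ _ s1)) (inclusion (im _ _ s2)))
      (c G1) (inclusion s1 x) =
    comp_hom (amalgam_homr (inclusion (im _ _ s1)) (inclusion (im _ _ s2)))
      (c G2) (inclusion s2 x).
  rewrite !comp_homE !hom_ofE.
  have := amalgam_glueE (inclusion (im _ _ s1)) (inclusion (im _ _ s2)) (c F x).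
  by congr (_ = _); [congr amalgam_inl | congr amalgam_inr]; apply: val_inj.
pose q := amalgam_hom c12.
have ql x : q (amalgam_inl _ _ x) = amalgam_inl _ _ (c G1 x).
  exact: amalgam_hom_inl.
have qr x : q (amalgam_inr _ _ x) = amalgam_inr _ _ (c G2 x).
  exact: amalgam_hom_inr.
have hq a : val (h (q a)) = phi (val (f a)).
  pose l := comp_hom (val_hom _) (comp_hom h q).
  pose r := comp_hom phi (comp_hom (val_hom _) f).
  suff lr : l =1 r by exact: lr.
  apply: amalgam_hom_ext => x.
    have -> : l (amalgam_inl _ _ x) = val (h (q (amalgam_inl _ _ x))) by [].
    by rewrite ql hl -[r _]/(phi (val (f (amalgam_inl _ _ x)))) fl.
  have -> : l (amalgam_inr _ _ x) = val (h (q (amalgam_inr _ _ x))) by [].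
  by rewrite qr hr -[r _]/(phi (val (f (amalgam_inr _ _ x)))) fr.
have c_surj A y : exists x, c A x = y.
  have [x Ax xy] := subgroup_val y.
  by exists (insubg Ax); apply: val_inj.
have q_surj a' : exists a, q a = a'.
  elim/amalgam_ind: a' => [|y _ [a <-]|y _ [a <-]].
  - by exists 1; exact: gmulf1.
  - have [x <-] := c_surj _ y.
    by exists (amalgam_inl _ _ x * a); rewrite gmulfM ql.
  - have [x <-] := c_surj _ y.
    by exists (amalgam_inr _ _ x * a); rewrite gmulfM qr.
exists h; split.
- apply: inj_surj_bijective.
    apply: hom_inj => a'; have [a <-] := q_surj a' => ha.
    have fa1 : phi (val (f a)) = 1 by rewrite -hq ha val1g.
    have Fa := kerF _ (subgroup_val (f a)) fa1.
    have -> : a = amalgam_inl _ _ (inclusion s1 (insubg Fa)).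
      by apply: (can_inj fK); apply: val_inj; rewrite fl.
    rewrite ql; have -> : c G1 (inclusion s1 (insubg Fa)) = 1.
      by apply: val_inj; rewrite val1g.
    exact: amalgam_inl1.
  move=> y; have [x Hx xy] := subgroup_val y.
  by exists (q (g (insubg Hx))); apply: val_inj; rewrite hq gK.
- by move=> y; rewrite hl.
- by move=> y; rewrite hr.
Qed.

End Images.

(** * The kernel and the theorem *)

Lemma cyclic_set_involution (G : groupType) (x : G) :
  x ^+ 2 = 1 -> cyclic_set x = [set 1; x].
Proof.
move=> xx.
have xV : x^-1 = x by apply: mulg1_eq; rewrite -expg2.
have xn k : x ^+ k = if odd k then x else 1.
  by elim: k => // k IHk; rewrite expgS IHk /=; case: odd;
    rewrite ?mulg1 -?expg2.
apply/seteqP; split=> [z [k [->|->]]|z [->|->]].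
- by rewrite xn; case: odd; [right | left].
- by rewrite xn; case: odd; rewrite ?xV ?invg1; [right | left].
- by exists 0%N; left.
- by exists 1%N; left.
Qed.

(** A conjugate of an element of a normal subgroup [{1, x}] is again in it. *)
Lemma kernel_pair_central (G K : groupType) (phi : group_hom G K) (x : G) :
  [set z | phi z = 1] = [set 1; x] ->
  forall z y, phi z = 1 -> commute z y.
Proof.
move=> kerE z y phiz.
have : [set z | phi z = 1] z by [].
rewrite kerE => -[->|zx]; first exact/commute_sym/commute1.
have : [set z | phi z = 1] (z ^ y).
  by rewrite /= conjgE !gmulfM gmulfV phiz mul1g mulVg.
rewrite kerE => -[/eqP|zyx].
  by rewrite conjg_eq1 => /eqP ->; exact/commute_sym/commute1.
by rewrite /commute conjgC zyx zx.
Qed.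

Theorem proposition12 (R : realType) (n : nat) (n_ge4 : (4 <= n)%N)
  (phi : group_hom (sphere_braid n) (mapping_class_group (marked R n)))
  (phi_canonical : canonical_hom phi)
  (phi_surjective : forall y, exists x, phi x = y)
  (phi_kernel : [set x | phi x = 1] = cyclic_set (full_twist n))
  (full_twist_order2 : full_twist n <> 1 /\ full_twist n ^+ 2 = 1) :
  (* (a) *)
  (forall H' : subgroup (mapping_class_group (marked R n)),
     (typeI H' -> typeI (preimage_subgroup phi H')) /\
     (typeII H' -> typeII (preimage_subgroup phi H'))) /\
  (* (b) *)
  (forall (H F : subgroup (sphere_braid n)) (theta : hom_Z_Aut F),
     typeI H -> finite_set F -> internal_sdprodZ H theta ->
     exists theta' : hom_Z_Aut (image_subgroup phi F),
       (forall (f' : image_subgroup phi F) (f : F),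
          phi (val f) = val f' ->
          val (theta' 1%R f') = phi (val (theta 1%R f))) /\
       internal_sdprodZ (image_subgroup phi H) theta') /\
  (* (c) *)
  (forall H G1 G2 F : subgroup (sphere_braid n),
     typeII H -> finite_set G1 -> finite_set G2 -> finite_set F ->
     internal_amalgam H G1 G2 F ->
     left_cosets G1 F #= `I_2 -> left_cosets G2 F #= `I_2 ->
     internal_amalgam (image_subgroup phi H) (image_subgroup phi G1)
       (image_subgroup phi G2) (image_subgroup phi F)).
Proof.
have tw2 : full_twist n ^+ 2 = 1 by case: full_twist_order2.
have kerE : [set x | phi x = 1] = [set 1; full_twist n].
  by rewrite phi_kernel cyclic_set_involution.
have finker : finite_set [set x | phi x = 1].
  by rewrite kerE; exact: finite_set2.
split; last split.
- move=> H'; have surj := restrict_surj phi_surjective (H' := H').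
  by split; [apply: typeI_pullback surj _ | apply: typeII_pullback surj _];
    exact: restrict_ker.
- move=> H F theta _ _ sdH.
  have tors z : phi z = 1 -> exists2 m, (0 < m)%N & z ^+ m = 1.
    move=> phiz; exists 2 => //; have : [set x | phi x = 1] z by [].
    by rewrite kerE => -[->|-> //]; exact: expg1n.
  have [theta' [theta'E sdH']] := internal_sdprodZ_image tors sdH.
  by exists theta'; split=> // f' f; exact: theta'E.
- move=> H G1 G2 F _ _ _ _ amH ind1 ind2.
  apply: internal_amalgam_image => //.
  + exact: kernel_pair_central kerE.
  + exact/left_cosets_index_two.
  + exact/left_cosets_index_two.
Qed.
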